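(* Let $G$ be a gyrogroup and let $(M(G),\nu)$ be its Grothendieck group completion. Let $K$ be any group and let $\eta: G\to K$ be a gyrogroup homomorphism. Then there exists a unique group homomorphism $\alpha: M(G)\to K$ such that $\alpha\circ\nu=\eta$.
   Context: A gyrogroup is a non-empty set $G$ with a binary operation $\circ$ such that: (1) there is $e\in G$ with $e\circ a=a$ for all $a\in G$; (2) for each $a\in G$ there is $a^{-1}\in G$ with $a^{-1}\circ a=e$; (3) for all $a,b\in G$ there is an automorphism $\mathrm{gyr}[a,b]$ of $(G,\circ)$ with $a\circ(b\circ c)=(a\circ b)\circ \mathrm{gyr}[a,b]c$ for all $c\in G$; (4) $\mathrm{gyr}[a\circ b,b]=\mathrm{gyr}[a,b]$ for all $a,b\in G$. Then $\mathrm{gyr}[a,b]z=(a\circ b)^{-1}\circ(a\circ(b\circ z))$. Every group is a gyrogroup (with all $\mathrm{gyr}[a,b]$ the identity). A gyrogroup homomorphism is a map $\eta$ with $\eta(a\circ b)=\eta(a)\circ\eta(b)$, the right-hand product being taken in the target. Grothendieck group completion. Put $G^*=G\setminus\{e\}$. Each $f\in \mathrm{Sym}(G^* )$ is regarded as a permutation of $G$ by setting $f(e)=e$. For $f\in\mathrm{Sym}(G^* )$ and $a\in G$, let $\sigma_a(f)\in\mathrm{Sym}(G^* )$ be defined by $f(a)\circ\sigma_a(f)(b)=f(a\circ b)$. The set $G\times\mathrm{Sym}(G^* )$ is a group under $(a,f)\cdot(b,g)=(a\circ f(b),\ \mathrm{gyr}[a,f(b)]\,\sigma_b(f)\,g)$,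 with identity $(e,I)$, where $I$ is the identity map. Let $R(G)\le \mathrm{Sym}(G^* )$ be the subgroup generated by all $\mathrm{gyr}[a,b]$, $a,b\in G$, identified with $\{e\}\times R(G)$, and identify $a \in G$ with $(a,I)$. The subgroup generated by $G\times\{I\}$ is $G R(G):=G\times R(G)$. Let $[R(G)]$ be the smallest normal subgroup of $GR(G)$ containing $\{e\}\times R(G)$. Put $M(G)=GR(G)/[R(G)]$ and $\nu:G\to M(G)$, $\nu(a)=(a,I)[R(G)]$. The pair $(M(G),\nu)$ is the Grothendieck group completion of $G$. *)

(* Defs.v *)
From HB Require Import structures.
From mathcomp Require Import all_boot.
From mathcomp Require Import boolp classical_sets.

Set Implicit Arguments.
Unset Strict Implicit.
Unset Printing Implicit Defensive.

Local Open Scope group_scope.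
Local Open Scope classical_set_scope.
Local Open Scope quotient_scope.

(* The identity, the inverses and the gyroautomorphisms are data here; the
   axioms determine them from the product, so this is the same notion as with
   existential axioms. [x * y] and [1] are the library's notations for
   a bare pointed magma: the product is not assumed associative. *)
HB.mixin Record BaseUMagma_isGyrogroup G of BaseUMagma G := {
  ginv : G -> G;
  gyr : G -> G -> G -> G;
  gyr_mul1 : left_id 1 (@mul G);
  gyr_mulV : left_inverse 1 ginv (@mul G);
  gyr_bij : forall a b, bijective (gyr a b);
  gyrM : forall a b, {morph gyr a b : x y / x * y};
  gyrA : forall a b c, a * (b * c) = (a * b) * gyr a b c;
  gyr_loop : forall a b, gyr (a * b) b = gyr a b
}.

#[short(type="gyrogroupType")]
HB.structure Definition Gyrogroup :=
  {G of BaseUMagma_isGyrogroup G & BaseUMagma G & Choice G}.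

Bind Scope group_scope with Gyrogroup.sort.

Section GyrogroupTheory.
Variable G : gyrogroupType.
Implicit Types a b c x y z : G.

Lemma gyr_mulI a : injective (fun x => a * x).
Proof.
move=> x y /(congr1 (fun z => ginv a * z)).
by rewrite !gyrA gyr_mulV !gyr_mul1; apply: (bij_inj (gyr_bij _ _)).
Qed.

Lemma gyr1x b c : gyr 1 b c = c.
Proof. by apply: (@gyr_mulI b); have := gyrA 1 b c; rewrite !gyr_mul1. Qed.

Lemma gyr_mulKg a c : ginv a * (a * c) = c.
Proof. by rewrite gyrA gyr_mulV gyr_mul1 -gyr_loop gyr_mulV gyr1x. Qed.

Lemma gyr_mulg1 a : a * 1 = a.
Proof. by apply: (@gyr_mulI (ginv a)); rewrite gyr_mulKg gyr_mulV. Qed.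

Lemma gyr_invgK a : ginv (ginv a) = a.
Proof. by rewrite -[RHS](gyr_mulKg (ginv a)) gyr_mulV gyr_mulg1. Qed.

Lemma gyr_mulVKg a c : a * (ginv a * c) = c.
Proof. by rewrite -{1}[a]gyr_invgK gyr_mulKg. Qed.

Lemma gyr_mulgV a : a * ginv a = 1.
Proof. by rewrite -{1}[a]gyr_invgK gyr_mulV. Qed.

Lemma gyr_map1 a b : gyr a b 1 = 1.
Proof.
apply: (@gyr_mulI (gyr a b 1)).
by rewrite -gyrM gyr_mul1 gyr_mulg1.
Qed.

Lemma gyrE a b z : gyr a b z = ginv (a * b) * (a * (b * z)).
Proof. by rewrite (gyrA a b z) gyr_mulKg. Qed.

Lemma gyrx1 a c : gyr a 1 c = c.
Proof. by rewrite gyrE gyr_mulg1 gyr_mul1 gyr_mulKg. Qed.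

Lemma gyr_mul_bij a : bijective (fun x => a * x).
Proof.
by exists (fun x => ginv a * x) => x; rewrite ?gyr_mulKg ?gyr_mulVKg.
Qed.

End GyrogroupTheory.

Section SymStar.
Variable G : gyrogroupType.

(* Permutations of G \ {e}, extended to G by fixing e. *)
Record symstar := SymStar {
  symfun :> G -> G;
  symfunP : `[< bijective symfun /\ symfun 1 = 1 >]
}.

HB.instance Definition _ := [isSub for symfun].
HB.instance Definition _ := [Choice of symstar by <:].

Implicit Types f g h : symstar.

Lemma sym_bij f : bijective f.
Proof. by case: f => f /= /asboolP[]. Qed.

Lemma sym1 f : f 1 = 1.
Proof. by case: f => f /= /asboolP[]. Qed.

Lemma symP f g : f =1 g -> f = g.
Proof. by move=> fg; apply: val_inj; apply/funext. Qed.

Definition mk_symstar (f : G -> G) (f_bij : bijective f) (f1 : f 1 = 1) :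
  symstar := SymStar (asboolT (conj f_bij f1)).

Lemma sym_inv_proof f :
  {g : symstar | cancel (symfun f) (symfun g)
               & cancel (symfun g) (symfun f)}.
Proof.
apply: cid2; case: (sym_bij f) => g fK gK.
have g_bij : bijective g by exists f.
have g1 : g 1 = 1 by rewrite -{1}(sym1 f) fK.
by exists (mk_symstar g_bij g1).
Qed.

Definition sym_one := @mk_symstar id (inv_bij (fun=> erefl)) erefl.
Definition sym_inv f := s2val (sym_inv_proof f).

Lemma sym_mul1 f g : f (g 1) = 1. Proof. by rewrite !sym1. Qed.
Definition sym_mul f g := mk_symstar (bij_comp (sym_bij f) (sym_bij g))
                                     (sym_mul1 f g).

Lemma sym_mulA : associative sym_mul. Proof. by move=> f g h; apply: symP. Qed.
Lemma sym_mul1f : left_id sym_one sym_mul.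
Proof. by move=> f; apply: symP. Qed.
Lemma sym_mulf1 : right_id sym_one sym_mul.
Proof. by move=> f; apply: symP. Qed.
Lemma sym_mulVf : left_inverse sym_one sym_inv sym_mul.
Proof. by move=> f; apply: symP => x; apply: (s2valP (sym_inv_proof f)). Qed.
Lemma sym_mulfV : right_inverse sym_one sym_inv sym_mul.
Proof. by move=> f; apply: symP => x; apply: (s2valP' (sym_inv_proof f)). Qed.

HB.instance Definition _ :=
  isGroup.Build symstar sym_mulA sym_mul1f sym_mulf1 sym_mulVf sym_mulfV.

Lemma sym_mulE f g x : (f * g) x = f (g x). Proof. by []. Qed.
Lemma sym_1E x : (1 : symstar) x = x. Proof. by []. Qed.
Lemma symK f x : f^-1 (f x) = x. Proof. by rewrite -sym_mulE mulVg. Qed.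
Lemma symVK f x : f (f^-1 x) = x. Proof. by rewrite -sym_mulE mulgV. Qed.

Definition gyr_sym (a b : G) : symstar :=
  mk_symstar (gyr_bij a b) (gyr_map1 a b).

Definition sigma_fun (a : G) (f : symstar) (b : G) : G := ginv (f a) * f (a * b).

Lemma sigma_bij a f : bijective (sigma_fun a f).
Proof.
apply: (bij_comp (gyr_mul_bij (ginv (f a)))).
exact: (bij_comp (sym_bij f) (gyr_mul_bij a)).
Qed.

Lemma sigma_1 a f : sigma_fun a f 1 = 1.
Proof. by rewrite /sigma_fun gyr_mulg1 gyr_mulV. Qed.

Definition sigma (a : G) (f : symstar) : symstar :=
  mk_symstar (sigma_bij a f) (sigma_1 a f).

Lemma sigmaE a f b : f a * sigma a f b = f (a * b).
Proof. exact: gyr_mulVKg. Qed.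

Lemma sigmaP a f g : (forall b, f a * g b = f (a * b)) -> g = sigma a f.
Proof.
by move=> fg; apply: symP => b; apply: (@gyr_mulI _ (f a)); rewrite fg sigmaE.
Qed.

End SymStar.

Section GyroExtension.
Variable G : gyrogroupType.

(* The underlying set of the group is G x Sym(G \ {e}); a record is used
   because the library puts the componentwise product on pairs. *)
Record gyrext := GyrExt { gext_pt : G; gext_sym : symstar G }.

HB.instance Definition _ := gen_eqMixin gyrext.
HB.instance Definition _ := gen_choiceMixin gyrext.

Definition gyrext_mul (p q : gyrext) : gyrext :=
  let: GyrExt a f := p in let: GyrExt b g := q in
  GyrExt (a * f b) (gyr_sym a (f b) * sigma b f * g).

Definition gyrext_one : gyrext := GyrExt 1 1.

(* The pair (a, f) acts faithfully on G as x |-> a * f x. *)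
Definition gyrext_act (p : gyrext) (x : G) : G := gext_pt p * gext_sym p x.

Lemma gyrext_act_inj p q : gyrext_act p =1 gyrext_act q -> p = q.
Proof.
case: p q => [a f] [b g] pq.
have ab : a = b by have := pq 1; rewrite /gyrext_act /= !sym1 !gyr_mulg1.
rewrite ab in pq *; congr GyrExt; apply: symP => x.
exact: (gyr_mulI (pq x)).
Qed.

Lemma gyrext_actM p q x :
  gyrext_act (gyrext_mul p q) x = gyrext_act p (gyrext_act q x).
Proof.
case: p q => [a f] [b g]; rewrite /gyrext_act /=.
by rewrite -[gyr a _ _]/(gyr a (f b) (sigma b f (g x))) -gyrA sigmaE.
Qed.

Lemma gyrext_act1 x : gyrext_act gyrext_one x = x.
Proof. exact: gyr_mul1. Qed.

Lemma gyrext_inv_bij (p : gyrext) :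
  bijective (fun x => ginv ((gext_sym p)^-1 (ginv (gext_pt p))) *
                      (gext_sym p)^-1 (ginv (gext_pt p) * x)).
Proof.
apply: (bij_comp (gyr_mul_bij _)).
exact: (bij_comp (sym_bij _) (gyr_mul_bij _)).
Qed.

Lemma gyrext_inv_1 (p : gyrext) :
  ginv ((gext_sym p)^-1 (ginv (gext_pt p))) *
  (gext_sym p)^-1 (ginv (gext_pt p) * 1) = 1.
Proof. by rewrite gyr_mulg1 gyr_mulV. Qed.

Definition gyrext_inv (p : gyrext) : gyrext :=
  GyrExt ((gext_sym p)^-1 (ginv (gext_pt p)))
         (mk_symstar (gyrext_inv_bij p) (gyrext_inv_1 p)).

Lemma gyrext_actV p x : gyrext_act (gyrext_inv p) (gyrext_act p x) = x.
Proof. by rewrite /gyrext_act /= gyr_mulVKg gyr_mulKg symK. Qed.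

Lemma gyrext_actVK p x : gyrext_act p (gyrext_act (gyrext_inv p) x) = x.
Proof. by rewrite /gyrext_act /= gyr_mulVKg symVK gyr_mulVKg. Qed.

Lemma gyrext_mulA : associative gyrext_mul.
Proof. by move=> p q r; apply: gyrext_act_inj => x; rewrite !gyrext_actM. Qed.
Lemma gyrext_mul1p : left_id gyrext_one gyrext_mul.
Proof.
by move=> p; apply: gyrext_act_inj => x; rewrite gyrext_actM gyrext_act1.
Qed.
Lemma gyrext_mulp1 : right_id gyrext_one gyrext_mul.
Proof.
by move=> p; apply: gyrext_act_inj => x; rewrite gyrext_actM gyrext_act1.
Qed.
Lemma gyrext_mulVp : left_inverse gyrext_one gyrext_inv gyrext_mul.
Proof.
move=> p; apply: gyrext_act_inj => x.
by rewrite gyrext_actM gyrext_actV gyrext_act1.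
Qed.
Lemma gyrext_mulpV : right_inverse gyrext_one gyrext_inv gyrext_mul.
Proof.
move=> p; apply: gyrext_act_inj => x.
by rewrite gyrext_actM gyrext_actVK gyrext_act1.
Qed.

HB.instance Definition _ := isGroup.Build gyrext
  gyrext_mulA gyrext_mul1p gyrext_mulp1 gyrext_mulVp gyrext_mulpV.

End GyroExtension.

Section Subgroups.
Variable H : groupType.

Definition subgroup (S : set H) : Prop :=
  [/\ S 1, forall x y, S x -> S y -> S (x * y) & forall x, S x -> S x^-1].

Definition normal_subgroup (N : set H) : Prop :=
  subgroup N /\ forall x y, N x -> N (x ^ y).

Definition generated (A : set H) : set H := smallest subgroup A.

Definition normal_closure (A : set H) : set H := smallest normal_subgroup A.

Lemma subgroup_generated A : subgroup (generated A).
Proof.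
split=> [S [[S1 _ _] _] //|x y Ax Ay S SA|x Ax S SA].
  by have [[_ SM _] _] := SA; apply: SM; [apply: Ax | apply: Ay].
by have [[_ _ SV] _] := SA; apply: SV; apply: Ax.
Qed.

Lemma normal_closure_normal A : normal_subgroup (normal_closure A).
Proof.
split; first split=> [S [[[S1 _ _] _] _] //|x y Ax Ay S SA|x Ax S SA].
- by have [[[_ SM _] _] _] := SA; apply: SM; [apply: Ax | apply: Ay].
- by have [[[_ _ SV] _] _] := SA; apply: SV; apply: Ax.
- by move=> x y Ax S SA; have [[_ SJ] _] := SA; apply: SJ; apply: Ax.
Qed.

End Subgroups.

Section QuotientByNormalClosure.
Variables (H : groupType) (A : set H).
Local Notation N := (normal_closure A).

(* x and y lie in the same left coset of the normal closure of A. *)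
Definition ncoset_rel (x y : H) : bool := `[< N (x^-1 * y) >].

Lemma ncoset_rel_refl : reflexive ncoset_rel.
Proof.
move=> x; apply/asboolP; rewrite mulVg.
by have [[]] := normal_closure_normal A.
Qed.

Lemma ncoset_rel_sym : symmetric ncoset_rel.
Proof.
suff imp x y : ncoset_rel x y -> ncoset_rel y x.
  by move=> x y; apply/idP/idP; apply: imp.
move=> /asboolP Nxy; apply/asboolP.
have [[_ _ NV] _] := normal_closure_normal A.
by have := NV _ Nxy; rewrite invgM invgK.
Qed.

Lemma ncoset_rel_trans : transitive ncoset_rel.
Proof.
move=> y x z /asboolP Nxy /asboolP Nyz; apply/asboolP.
have [[_ NM _] _] := normal_closure_normal A.
by have := NM _ _ Nxy Nyz; rewrite -mulgA mulVKg.
Qed.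

Canonical ncoset_equiv :=
  EquivRel ncoset_rel ncoset_rel_refl ncoset_rel_sym ncoset_rel_trans.

Definition nquot := {eq_quot ncoset_rel}.
HB.instance Definition _ := Choice.on nquot.
HB.instance Definition _ := Quotient.on nquot.
HB.instance Definition _ := EqQuotient.on nquot.

Definition ncoset (x : H) : nquot := \pi_nquot x.

Lemma ncoset_eqP x y : (ncoset x = ncoset y) <-> N (x^-1 * y).
Proof.
split=> [xy|Nxy]; first by have /eqmodP/asboolP := xy.
by apply/eqmodP/asboolP.
Qed.

Lemma ncoset_repr (u : nquot) : ncoset (repr u) = u.
Proof. exact: reprK. Qed.

Definition nquot_mul (u v : nquot) : nquot := ncoset (repr u * repr v).
Definition nquot_inv (u : nquot) : nquot := ncoset (repr u)^-1.

Lemma nquot_mulE x y : nquot_mul (ncoset x) (ncoset y) = ncoset (x * y).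
Proof.
apply/ncoset_eqP; have [[_ NM _] NJ] := normal_closure_normal A.
have /ncoset_eqP Nx := ncoset_repr (ncoset x).
have /ncoset_eqP Ny := ncoset_repr (ncoset y).
have := NM _ _ (NJ _ (repr (ncoset y)) Nx) Ny.
by rewrite /conjg invgM !mulgA !mulgK.
Qed.

Lemma nquot_invE x : nquot_inv (ncoset x) = ncoset x^-1.
Proof.
apply/ncoset_eqP; have [[_ _ NV] NJ] := normal_closure_normal A.
have /ncoset_eqP Nx := ncoset_repr (ncoset x).
by have := NJ _ x^-1 (NV _ Nx); rewrite /conjg invgM !invgK mulgA mulVKg.
Qed.

Lemma nquot_mulA : associative nquot_mul.
Proof.
move=> u v w; rewrite -(ncoset_repr u) -(ncoset_repr v) -(ncoset_repr w).
by rewrite !nquot_mulE mulgA.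
Qed.
Lemma nquot_mul1u : left_id (ncoset 1) nquot_mul.
Proof. by move=> u; rewrite -(ncoset_repr u) nquot_mulE mul1g. Qed.
Lemma nquot_mulu1 : right_id (ncoset 1) nquot_mul.
Proof. by move=> u; rewrite -(ncoset_repr u) nquot_mulE mulg1. Qed.
Lemma nquot_mulVu : left_inverse (ncoset 1) nquot_inv nquot_mul.
Proof.
by move=> u; rewrite -(ncoset_repr u) nquot_invE nquot_mulE mulVg.
Qed.
Lemma nquot_muluV : right_inverse (ncoset 1) nquot_inv nquot_mul.
Proof.
by move=> u; rewrite -(ncoset_repr u) nquot_invE nquot_mulE mulgV.
Qed.

HB.instance Definition _ := isGroup.Build nquot
  nquot_mulA nquot_mul1u nquot_mulu1 nquot_mulVu nquot_muluV.

Lemma ncosetM : {morph ncoset : x y / x * y}.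
Proof. by move=> x y; rewrite -nquot_mulE. Qed.

HB.instance Definition _ := isMultiplicative.Build H nquot ncoset ncosetM.

End QuotientByNormalClosure.

Section Completion.
Variable G : gyrogroupType.

Definition Rgyr : set (symstar G) :=
  generated [set f | exists a b, f = gyr_sym a b].

Definition GR_pred (p : gyrext G) : bool := gext_sym p \in Rgyr.

Lemma Rgyr_morph (f : symstar G) : Rgyr f -> {morph f : x y / x * y}.
Proof.
move=> Rf; apply: (Rf [set g : symstar G | {morph g : x y / x * y}]).
split; last by move=> _ [a [b ->]]; exact: gyrM.
split=> [//|g h gM hM x y|g gM x y]; first by rewrite !sym_mulE hM gM.
by rewrite -{1}[x](symVK g) -{1}[y](symVK g) -gM symK.
Qed.

Lemma sigma_Rgyr (a : G) (f : symstar G) : Rgyr f -> sigma a f = f.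
Proof. by move=> Rf; apply/esym/sigmaP => b; rewrite Rgyr_morph. Qed.

Lemma Rgyr_gyr (a b : G) : Rgyr (gyr_sym a b).
Proof. by move=> S [_]; apply; exists a, b. Qed.

Lemma gyrext_mulE (p q : gyrext G) : Rgyr (gext_sym p) ->
  p * q = GyrExt (gext_pt p * gext_sym p (gext_pt q))
    (gyr_sym (gext_pt p) (gext_sym p (gext_pt q)) * gext_sym p * gext_sym q).
Proof.
by case: p q => [a f] [b g] /= Rf; congr GyrExt; rewrite sigma_Rgyr.
Qed.

Lemma GR_subgroup : subgroup [set p | GR_pred p].
Proof.
have [R1 RM RV] := subgroup_generated [set f | exists a b : G, f = gyr_sym a b].
split; first by rewrite /= /GR_pred; apply/mem_set.
  move=> p q /set_mem Rp /set_mem Rq; apply/mem_set.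
  rewrite gyrext_mulE //; apply: (RM _ _ _ Rq).
  by apply: (RM _ _ _ Rp); apply: Rgyr_gyr.
move=> p /set_mem Rp; apply/mem_set.
have := congr1 (@gext_sym G) (mulgV p); rewrite gyrext_mulE //.
set k := _ * gext_sym p => kh.
have -> : gext_sym p^-1 = k^-1 by apply: (mulgI k); rewrite mulgV -[RHS]kh.
by apply: RV; apply: RM => //; apply: Rgyr_gyr.
Qed.

Lemma GR_generated :
  [set p | GR_pred p] = generated [set p | exists a : G, p = GyrExt a 1].
Proof.
apply/seteqP; split; last first.
  apply: smallest_sub; first exact: GR_subgroup.
  move=> _ [a ->]; apply/mem_set => S [[S1 _ _] _]; exact: S1.
set T := generated _.
have [T1 TM TV] : subgroup T by apply: subgroup_generated.
have Tpt a : T (GyrExt a 1) by move=> S [_]; apply; exists a.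
have split_pt a f : GyrExt a f = GyrExt a 1 * GyrExt 1 f.
  apply: gyrext_act_inj => x.
  by rewrite gyrext_actM /gyrext_act /= gyr_mul1.
have emb f g : GyrExt (1 : G) (f * g) = GyrExt 1 f * GyrExt 1 g.
  apply: gyrext_act_inj => x.
  by rewrite gyrext_actM /gyrext_act /= !gyr_mul1.
case=> a f /set_mem /= Rf; rewrite split_pt; apply: (TM) => //.
apply: (Rf [set g | T (GyrExt 1 g)]); split.
  split=> [//|g h Tg Th|g Tg] /=; first by rewrite emb; apply: TM.
  suff -> : GyrExt 1 g^-1 = (GyrExt 1 g)^-1 by apply: TV.
  by apply: (mulgI (GyrExt 1 g)); rewrite -emb !mulgV.
move=> _ [b [c ->]] /=.
suff -> : GyrExt 1 (gyr_sym b c) =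
    (GyrExt (b * c) 1)^-1 * (GyrExt b 1 * GyrExt c 1).
  by apply: (TM); [apply: TV | apply: TM].
apply: (mulgI (GyrExt (b * c) 1)); rewrite mulVKg -split_pt.
apply: gyrext_act_inj => x.
by rewrite gyrext_actM /gyrext_act /= gyrA.
Qed.

(* The group G R(G) = G x R(G). *)
Record GR := MkGR { GRval :> gyrext G; GRvalP : GR_pred GRval }.

HB.instance Definition _ := [isSub for GRval].
HB.instance Definition _ := [Choice of GR by <:].

Lemma GR_closed : group_closed GR_pred.
Proof.
have [S1 SM SV] := GR_subgroup.
by split=> // x y Sx Sy; apply: SM => //; apply: SV.
Qed.

HB.instance Definition _ :=
  SubChoice_isSubGroup.Build (gyrext G) GR_pred GR GR_closed.

(* {e} x R(G), as a subset of G R(G). *)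
Definition RinGR : set GR := [set x | gext_pt x = 1].

(* M(G) = G R(G) / [R(G)]. *)
Definition gcompletion : groupType := nquot RinGR.

Lemma GR_pt (a : G) : GR_pred (GyrExt a 1).
Proof. by apply/mem_set => S [[S1 _ _] _]. Qed.

Definition gnu (a : G) : gcompletion := ncoset RinGR (MkGR (GR_pt a)).

End Completion.

(* Main.v *)
(** Every gyration is invisible to a homomorphism [eta] into a group, because
    [eta (a * (b * c))] can be reassociated there. Hence [(a, f) |-> eta a] is
    a homomorphism on [G R(G)] that kills [{e} x R(G)], and it descends to
    [M(G)]. Uniqueness holds because [nu] is onto: [(a, f) = (a, I) (e, f)]. *)

Require Import Defs.
From HB Require Import structures.
From mathcomp Require Import all_boot.
From mathcomp Require Import boolp classical_sets.

Set Implicit Arguments.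
Unset Strict Implicit.
Unset Printing Implicit Defensive.

Local Open Scope group_scope.
Local Open Scope classical_set_scope.

(** Uniqueness in the theorem concerns bundled morphisms; proof irrelevance reduces it to equality
    of the underlying maps. *)
Lemma multiplicative_eq (G H : magmaType)
    (f g : {multiplicative G -> H}) : f = g :> (G -> H) -> f = g.
Proof.
case: f g => [f [[fM]]] [g [[gM]]] /= fg; case: g / fg gM => gM.
by rewrite (Prop_irrelevance fM gM).
Qed.

Lemma multiplicative1 (G : gyrogroupType) (K : groupType)
    (eta : {multiplicative G -> K}) : eta 1 = 1.
Proof. by apply: (mulgI (eta 1)); rewrite -gmulfM gyr_mul1 mulg1. Qed.

Lemma multiplicative_gyr (G : gyrogroupType) (K : groupType)
    (eta : {multiplicative G -> K}) (a b c : G) : eta (gyr a b c) = eta c.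
Proof.
apply: (mulgI (eta (a * b))).
by rewrite -gmulfM -gyrA !gmulfM mulgA.
Qed.

Lemma multiplicative_Rgyr (G : gyrogroupType) (K : groupType)
    (eta : {multiplicative G -> K}) (f : symstar G) (x : G) :
  Rgyr f -> eta (f x) = eta x.
Proof.
move=> Rf; move: x.
(* Minimality of R(G): the [g] with [eta \o g = eta] form a subgroup containing every gyration. *)
apply: (Rf [set g : symstar G | forall x, eta (g x) = eta x]); split.
  split=> [//|g h gK hK x|g gK x]; first by rewrite sym_mulE gK hK.
  by rewrite -gK symVK.
by move=> _ [a [b ->]] x; apply: multiplicative_gyr.
Qed.

Lemma normal_subgroup_ker (H K : groupType) (phi : UMagmaMorphism.type H K) :
  normal_subgroup [set x | phi x = 1].
Proof.
split; first split=> [|x y /= px py|x /= px].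
- exact: gmulf1.
- by rewrite gmulfM px py mulg1.
- by rewrite gmulfV px invg1.
- by move=> x y /= px; rewrite gmulfJ px conj1g.
Qed.

Lemma nquot_lift (H K : groupType) (A : set H)
    (phi : UMagmaMorphism.type H K) :
  (forall x, A x -> phi x = 1) ->
  exists alpha : {multiplicative nquot A -> K},
    forall x, alpha (ncoset A x) = phi x.
Proof.
move=> phiA.
pose alpha (u : nquot A) := phi (repr u).
have alphaE x : alpha (ncoset A x) = phi x.
  have /ncoset_eqP N := ncoset_repr (ncoset A x).
  (* The kernel of [phi] is a normal subgroup containing [A], so it contains the normal closure, in
     particular [(repr (ncoset A x))^-1 * x]. *)
  have /= := N _ (conj (normal_subgroup_ker phi) phiA).
  by rewrite gmulfM gmulfV => /(canRL (mulVKg _)); rewrite mulg1.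
have alphaM : {morph alpha : u v / u * v}.
  move=> u v; rewrite -(ncoset_repr u) -(ncoset_repr v) -gmulfM.
  by rewrite !alphaE gmulfM.
pose alpha_mixin := isMultiplicative.Build (nquot A) K alpha alphaM.
by exists (HB.pack_for {multiplicative nquot A -> K} alpha alpha_mixin).
Qed.

Section Evaluation.
Variables (G : gyrogroupType) (K : groupType) (eta : {multiplicative G -> K}).

Definition GR_eval (p : GR G) : K := eta (gext_pt (GRval p)).

(** The product of [(a, f)] and [(b, g)] has first coordinate [a * f b], and [eta (f b) = eta b]
    since [f] lies in R(G). *)
Lemma GR_evalM : {morph GR_eval : p q / p * q}.
Proof.
move=> [p Rp] [q Rq].
have Rp' : Rgyr (gext_sym p) by exact: set_mem Rp.
rewrite /GR_eval -[GRval (_ * _)]/(p * q) gyrext_mulE //= gmulfM.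
by rewrite multiplicative_Rgyr.
Qed.

HB.instance Definition _ := isUMagmaMorphism.Build (GR G) K GR_eval
  (multiplicative1 eta, GR_evalM).

End Evaluation.

(** This is the surjectivity of [gnu], with an explicit preimage for each coset. *)
Lemma ncoset_GR (G : gyrogroupType) (p : GR G) :
  ncoset (@RinGR G) p = gnu (gext_pt (GRval p)).
Proof.
pose q := MkGR (GR_pt (gext_pt (GRval p))); pose r := q^-1 * p.
suff Rr : RinGR r by apply/esym/ncoset_eqP => S [_]; apply.
(* With [q = (a, I)] and [r = (b, g)], comparing first coordinates in [q * r = p] gives [a * b = a],
   and left cancellation yields [b = 1]. *)
have : gext_pt (GRval (q * r)) = gext_pt (GRval p) by rewrite mulVKg.
rewrite -[GRval (q * r)]/(GRval q * GRval r) /RinGR /mkset.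
case: (GRval r) => b g /= ab.
by apply: (@gyr_mulI _ (gext_pt (GRval p))); rewrite gyr_mulg1.
Qed.

Theorem theorem2p3 (G : gyrogroupType) (K : groupType)
    (eta : {multiplicative G -> K}) :
  exists! alpha : {multiplicative gcompletion G -> K},
    (alpha \o @gnu G)%FUN = eta :> (G -> K).
Proof.
have eval_R (p : GR G) : RinGR p -> GR_eval eta p = 1.
  by move=> Rp; rewrite /GR_eval Rp multiplicative1.
have [alpha alphaE] := nquot_lift eval_R.
have alpha_nu : (alpha \o @gnu G)%FUN = eta :> (G -> K).
  by apply/funext => a; rewrite /= alphaE.
exists alpha; split=> // beta beta_nu.
apply/multiplicative_eq/funext => u.
rewrite -(ncoset_repr u) ncoset_GR.
(* By now [u] is a value of [gnu], where both maps agree with [eta]. *)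
exact: (congr1 (@^~ _) (etrans alpha_nu (esym beta_nu))).
Qed.
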